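(* The class $\mathsf T_\omega$ of all trees is well-quasi-ordered by the tree-homomorphism relation $\preceq_h$. That is, $\preceq_h$ is a quasi-order on $\mathsf T_\omega$, and for every infinite sequence $T_0,T_1,T_2,\dots$ of trees there are indices $i<j$ such that $T_i\preceq_h T_j$.
   Context: The axiom of choice is assumed. A tree is a partially ordered set $(T,<_T)$ such that for every $x\in T$ the set $\{y\in T : y<_T x\}$ is a finite chain, and $T$ has a unique minimal element (the root). Trees may be infinite, with nodes having arbitrarily many immediate successors. $\mathsf T_\omega$ denotes the class of all trees. A homomorphism from a tree $S$ to a tree $T$ is a map $\varphi\colon S\to T$ such that $x<_S y$ implies $\varphi(x)<_T\varphi(y)$ for all $x,y\in S$ (not necessarily injective). One writes $S\preceq_h T$ if there exists a homomorphism from $S$ to $T$. A quasi-order is a reflexive and transitive relation. *)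

(* Defs.v *)
From Stdlib Require Import RelationClasses Ensembles Finite_sets.

(** The nodes carry the strict order [<_T]. *)
Record tree := Tree {
  node :> Type;
  tree_lt : node -> node -> Prop;
  tree_lt_strict : StrictOrder tree_lt;
  tree_below_finite : forall x : node, Finite node (fun y => tree_lt y x);
  tree_below_chain : forall x y z : node,
    tree_lt y x -> tree_lt z x -> tree_lt y z \/ y = z \/ tree_lt z y;
  tree_root_unique : exists! r : node, forall y : node, ~ tree_lt y r
}.

Definition tree_hom (S T : tree) (phi : S -> T) : Prop :=
  forall x y : S, tree_lt S x y -> tree_lt T (phi x) (phi y).

Definition hom_le (S T : tree) : Prop := exists phi : S -> T, tree_hom S T phi.

Definition well_quasi_order {A : Type} (R : A -> A -> Prop) : Prop :=
  PreOrder R /\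
  forall u : nat -> A, exists i j : nat, i < j /\ R (u i) (u j).

(* Main.v *)
Require Import Defs.
From Stdlib Require Import RelationClasses Ensembles Finite_sets.
From Stdlib Require Import Classical ClassicalEpsilon FunctionalExtensionality.
From Stdlib Require Import List Lia.

(** A tree whose reversed order is well-founded has an ordinal rank, and such
    trees are compared by their ranks; a tree with an infinite branch receives
    every tree.  So the quasi-order is linear and well-founded, hence a
    well-quasi-order.

    The proof below replaces ranks by simulations: [sim a b] is the greatest
    relation between nodes such that, when it relates [a] to [b], it relates
    every node above [a] to some node above [b]; say then that [a] is simulated
    by [b].  It plays the role of [rank a <= rank b], where a node on an
    infinite branch has a rank that exceeds every ordinal.

    - A simulation of the root of [S] is turned into a homomorphism by recursion
      along the order of [S] ([hom_of_sim]); the finite chains of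
      predecessors make this recursion possible, since the image of a node needs
      only to be placed above the image of its immediate predecessor.
    - A node that is not accessible for the reversed order lies on an infinite
      branch, so every node is simulated by it ([sim_of_not_acc]).
    - If [sim a b] fails, then [b] is still simulated by some node above [a]
      ([exists_above_sim]): this says that [rank b < rank a] implies
      [rank b <= rank a'] for some [a' > a].

    Along a sequence of trees whose ranks strictly decrease, the last fact gives
    a strictly increasing sequence of nodes in one tree of the sequence, which
    may be chosen without infinite branch ([no_infinite_descent]).  Hence already
    two consecutive trees of any sequence are comparable. *)

(** * Simulations between nodes *)

Definition simulation (S T : tree) (R : S -> T -> Prop) : Prop :=
  forall a b, R a b ->
  forall a', tree_lt S a a' -> exists b', tree_lt T b b' /\ R a' b'.

(** The union of all simulations, which is again one ([sim_step]).  Taking the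
    greatest such relation makes sense without well-foundedness, so that trees
    with infinite branches need no separate notion of rank. *)
Definition sim {S T : tree} (a : S) (b : T) : Prop :=
  exists R, simulation S T R /\ R a b.

Lemma sim_step (S T : tree) : simulation S T sim.
Proof.
intros a b [R [HR Hab]] a' Ha.
destruct (HR a b Hab a' Ha) as [b' [Hb Hab']].
exists b'; split; [exact Hb | exists R; auto].
Qed.

Lemma sim_trans (S T U : tree) (a : S) (b : T) (c : U) :
  sim a b -> sim b c -> sim a c.
Proof.
intros Hab Hbc.
exists (fun x z => exists y : T, sim x y /\ sim y z); split; [| now exists b].
intros x z [y [Hxy Hyz]] x' Hx.
destruct (sim_step _ _ _ _ Hxy _ Hx) as [y' [Hy Hxy']].
destruct (sim_step _ _ _ _ Hyz _ Hy) as [z' [Hz Hyz']].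
exists z'; split; [exact Hz | now exists y'].
Qed.

(** Closure of the greatest simulation under one step: the hypothesis, read as a
    relation between [a] and [b], becomes a simulation when joined with [sim]. *)
Lemma sim_intro (S T : tree) (a : S) (b : T) :
  (forall a', tree_lt S a a' -> exists b', tree_lt T b b' /\ sim a' b') ->
  sim a b.
Proof.
intros H.
exists (fun x y => sim x y \/
  forall x', tree_lt S x x' -> exists y', tree_lt T y y' /\ sim x' y').
split; [| now right].
intros x y [Hxy | Hxy] x' Hx.
- destruct (sim_step _ _ _ _ Hxy x' Hx) as [y' [Hy Hxy']]; eauto.
- destruct (Hxy x' Hx) as [y' [Hy Hxy']]; eauto.
Qed.

Lemma not_sim_witness (S T : tree) (a : S) (b : T) :
  ~ sim a b ->
  exists a', tree_lt S a a' /\ forall b', tree_lt T b b' -> ~ sim a' b'.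
Proof.
intros H; apply NNPP; intros Hno; apply H, sim_intro.
intros a' Ha; apply NNPP; intros Hno'; apply Hno.
exists a'; split; [exact Ha |].
intros b' Hb Hs; apply Hno'; now exists b'.
Qed.

(** The simulation used here expresses [rank b <= rank a'] negatively, as
    [rank b' < rank a'] for all [b' > b]; [not_sim_witness] provides both its
    instance at [b] and [a'] and the step that makes it a simulation. *)
Lemma exists_above_sim (S T : tree) (a : S) (b : T) :
  ~ sim a b -> exists a', tree_lt S a a' /\ sim b a'.
Proof.
intros H; destruct (not_sim_witness _ _ _ _ H) as [a' [Ha Ha']].
exists a'; split; [exact Ha |].
exists (fun (y : T) (x : S) => forall y', tree_lt T y y' -> ~ sim x y').
split; [| exact Ha'].
intros y x Hyx y' Hy; exact (not_sim_witness _ _ _ _ (Hyx y' Hy)).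
Qed.

(** * Descent *)

Definition tree_gt (T : tree) (x y : T) : Prop := tree_lt T y x.

(** From a node that is not accessible one can climb to another one, forever. *)
Lemma sim_of_not_acc (S T : tree) (a : S) (b : T) :
  ~ Acc (tree_gt T) b -> sim a b.
Proof.
intros Hb; exists (fun _ y => ~ Acc (tree_gt T) y); split; [| exact Hb].
intros _ y Hy _ _; apply NNPP; intros Hno; apply Hy; constructor.
intros y' Hy'; apply NNPP; intros Hn; apply Hno; now exists y'.
Qed.

(** Each failure of [sim] at the head of the sequence is paid for by a climb from
    [x] to a node by which that head is simulated, and this node then takes the
    place of [x] against the rest of the sequence. *)
Lemma no_infinite_descent (S : tree) (x : S) :
  Acc (tree_gt S) x ->
  forall (U : nat -> tree) (u : forall n, U n),
  ~ sim x (u 0) -> exists n, sim (u n) (u (n + 1)).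
Proof.
induction 1 as [x _ IH]; intros U u Hx.
destruct (exists_above_sim _ _ _ _ Hx) as [x' [Hlt Hs]].
destruct (classic (sim x' (u 1))) as [H1 | H1].
- exists 0; exact (sim_trans _ _ _ _ _ _ Hs H1).
- destruct (IH x' Hlt (fun n => U (1 + n)) (fun n => u (1 + n)) H1) as [n Hn].
  now exists (1 + n).
Qed.

(** * From simulations to homomorphisms *)

Lemma finite_covered_by_list (A : Type) (X : Ensemble A) :
  Finite A X -> exists l : list A, forall y, X y -> In y l.
Proof.
induction 1 as [| X _ [l Hl] x _].
- exists nil; intros y [].
- exists (x :: l)%list.
  intros y [y' Hy | y' Hy]; [right; auto | left; now destruct Hy].
Qed.

Lemma tree_lt_wf (T : tree) : well_founded (tree_lt T).
Proof.
assert (H : forall n l x, length l = n ->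
          (forall y, tree_lt T y x -> In y l) -> Acc (tree_lt T) x).
{ induction n as [| n IH]; intros l x Hl Hx; constructor; intros y Hy.
  - destruct l; [destruct (Hx y Hy) | discriminate].
  - destruct (in_split y l (Hx y Hy)) as [l1 [l2 ->]].
    rewrite length_app in Hl; simpl in Hl.
    apply (IH (l1 ++ l2)%list); [rewrite length_app; lia |].
    intros z Hz; destruct (tree_lt_strict T) as [Hirr Htr].
    destruct (in_app_or _ _ _ (Hx z (Htr _ _ _ Hz Hy))) as [Hz1 | [<- | Hz2]].
    + apply in_or_app; now left.
    + destruct (Hirr _ Hz).
    + apply in_or_app; now right. }
intros x.
destruct (finite_covered_by_list _ _ (tree_below_finite T x)) as [l Hl].
exact (H _ l x eq_refl Hl).
Qed.

Lemma finite_chain_max (A : Type) (lt : A -> A -> Prop) (X : Ensemble A) :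
  StrictOrder lt -> Finite A X ->
  (forall y z, X y -> X z -> lt y z \/ y = z \/ lt z y) ->
  (exists y, X y) -> exists m, X m /\ forall y, X y -> y = m \/ lt y m.
Proof.
intros [_ Htr] HX.
induction HX as [| X HX IH x Hx]; intros Hch [y0 Hy0]; [destruct Hy0 |].
assert (HxX : Ensembles.Add A X x x) by (right; constructor).
assert (HX' : forall y, X y -> Ensembles.Add A X x y) by (intros y Hy; now left).
destruct (classic (exists y, X y)) as [Hne | Hempty].
- destruct IH as [m [Hm Hmax]]; [intros; apply Hch; auto | exact Hne |].
  destruct (Hch m x (HX' m Hm) HxX) as [Hlt | [Heq | Hlt]].
  + exists x; split; [exact HxX |].
    intros y [y' Hy | y' Hy]; [right | left; now destruct Hy].
    destruct (Hmax _ Hy) as [-> | Hym]; [exact Hlt | exact (Htr _ _ _ Hym Hlt)].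
  + subst; contradiction.
  + exists m; split; [now apply HX' |].
    intros y [y' Hy | y' Hy]; [now apply Hmax |].
    destruct Hy; now right.
- exists x; split; [exact HxX |].
  intros y [y' Hy | y' Hy]; [exfalso; eauto | left; now destruct Hy].
Qed.

Lemma immediate_predecessor (T : tree) (x : T) :
  (exists y, tree_lt T y x) ->
  exists m, tree_lt T m x /\ forall y, tree_lt T y x -> y = m \/ tree_lt T y m.
Proof.
apply (finite_chain_max T (tree_lt T) (fun y => tree_lt T y x)
         (tree_lt_strict T) (tree_below_finite T x)).
intros y z; apply tree_below_chain.
Qed.

Definition is_root (T : tree) (r : T) : Prop := forall y, ~ tree_lt T y r.

(** The image of a node is chosen by well-founded recursion, above the images of
    all smaller nodes and so that the node is simulated by its image: this
    keeps the choice possible at the next nodes. *)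
Lemma hom_of_sim (S T : tree) (r : S) (s : T) :
  is_root S r -> sim r s -> hom_le S T.
Proof.
intros Hr Hrs.
pose (good := fun (x : S) (f : forall y, tree_lt S y x -> T) (b : T) =>
  sim x b /\ forall y (Hy : tree_lt S y x), tree_lt T (f y Hy) b).
pose (F := fun x f => epsilon (inhabits s) (good x f)).
pose (phi := Fix (tree_lt_wf S) (fun _ => T : Type) F).
assert (Hphi : forall x, phi x = F x (fun y _ => phi y)).
{ apply Fix_eq; intros x f g Hfg; f_equal.
  extensionality y; extensionality Hy; apply Hfg. }
assert (Hgood : forall x, good x (fun y _ => phi y) (phi x)).
{ intros x; induction x as [x IH] using (well_founded_induction (tree_lt_wf S)).
  rewrite (Hphi x); apply epsilon_spec.
  destruct (classic (exists y, tree_lt S y x)) as [Hne | Hempty].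
  - destruct (immediate_predecessor S x Hne) as [m [Hm Hmax]].
    destruct (IH m Hm) as [Hsim Hbelow].
    destruct (sim_step _ _ _ _ Hsim x Hm) as [b [Hb Hxb]].
    exists b; split; [exact Hxb |].
    intros y Hy; destruct (Hmax y Hy) as [-> | Hym]; [exact Hb |].
    destruct (tree_lt_strict T) as [_ Htr].
    exact (Htr _ _ _ (Hbelow y Hym) Hb).
  - assert (Hx : is_root S x) by (intros y Hy; apply Hempty; now exists y).
    destruct (tree_root_unique S) as [r' [_ Huniq]].
    exists s; split; [| intros y Hy; destruct (Hx y Hy)].
    now rewrite <- (Huniq x Hx), (Huniq r Hr). }
exists phi; intros x y Hxy; exact (proj2 (Hgood y) x Hxy).
Qed.

(** * The well-quasi-order *)

Lemma hom_le_preorder : PreOrder hom_le.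
Proof.
split.
- intros T; exists (fun x => x); intros x y Hxy; exact Hxy.
- intros S T U [f Hf] [g Hg]; exists (fun x => g (f x)).
  intros x y Hxy; apply Hg, Hf, Hxy.
Qed.

Lemma exists_sim_consecutive (U : nat -> tree) (u : forall n, U n) :
  exists n, sim (u n) (u (n + 1)).
Proof.
destruct (classic (sim (u 0) (u 1))) as [H0 | H0]; [now exists 0 |].
(* Even if [u 0] lies on an infinite branch, [u 1] does not, as [sim (u 0) (u 1)]
   fails: the descent starts from [u 1]. *)
assert (Hacc : Acc (tree_gt (U 1)) (u 1)).
{ apply NNPP; intros Hn; apply H0, sim_of_not_acc, Hn. }
destruct (classic (sim (u 1) (u 2))) as [H1 | H1]; [now exists 1 |].
destruct (no_infinite_descent _ _ Hacc (fun n => U (2 + n))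
            (fun n => u (2 + n)) H1) as [n Hn].
now exists (2 + n).
Qed.

Theorem theorem3p4 : well_quasi_order hom_le.
Proof.
split; [exact hom_le_preorder | intros u].
assert (Hroot : forall T : tree, exists r : T, is_root T r).
{ intros T; destruct (tree_root_unique T) as [r [Hr _]]; now exists r. }
pose (root := fun T => constructive_indefinite_description _ (Hroot T)).
destruct (exists_sim_consecutive u (fun n => proj1_sig (root (u n)))) as [n Hn].
exists n, (n + 1); split; [lia |].
exact (hom_of_sim _ _ _ _ (proj2_sig (root (u n))) Hn).
Qed.
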